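(* Let $p\in\mathbb{N}_0$, $n\in\mathbb{N}$, $a>1$, $\lambda>0$, let $h_0(n),\dots,h_n(n)$ be real numbers with $|h_j(n)|\le1$, and let $Z_0(n,a),\dots,Z_n(n,a)\in\mathbb{C}$. Put $z_j=-ih_j(n)$ and assume that the Gram matrix $\big(K_p(z_k,z_j)\big)_{0\le k,j\le n}$ is strictly positive definite, where $K_p$ is the reproducing kernel of $\mathcal{H}_p(\mathbb{C})$. Let $$f_{n,p}(z)=\sum_{j=0}^nZ_j(n,a)K_p(z,z_j)$$ be the Touchard superoscillation. For $w_0,\dots,w_n\in\mathbb{C}$ consider on $\mathcal{H}_p(\mathbb{C})$ the functional $$J(f)=\sum_{k=0}^n|w_k-f(z_k)|^2+\lambda\|f\|^2 .$$ Then $f_{n,p}$ is the minimizer of $J$ over $\mathcal{H}_p(\mathbb{C})$ if and only if $$w_k=\lambda Z_k(n,a)+\sum_{j=0}^nZ_j(n,a)\,K_p(-ih_k(n),-ih_j(n)),\qquad 0\le k\le n.$$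
   Context: For $p\in\mathbb{N}_0$, $\mathcal{H}_p(\mathbb{C})$ is the Hilbert space of functions $f(z)=\sum_{m\ge0}a_mz^m$ with $\|f\|^2=\sum_{m=0}^\infty\frac{|a_m|^2m!}{(m+1)^{2p}}<\infty$. Its reproducing kernel is $$K_p(z,w)=\frac{1}{z\overline w}T_{2p+1}(z\overline w)\,e^{z\overline w}$$ (extended by continuity at $z\overline w=0$), where $T_m(x)=\sum_{k=0}^mS(m,k)x^k$ are the Touchard polynomials and $S(m,k)=\frac1{k!}\sum_{i=0}^k(-1)^i\binom ki(k-i)^m$ are the Stirling numbers of the second kind. *)

(* Defs.v *)
From HB Require Import structures.
From mathcomp Require Import all_boot all_order all_algebra.
From mathcomp Require Import complex.
From mathcomp Require Import all_classical all_reals all_analysis.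

Set Implicit Arguments.
Unset Strict Implicit.
Unset Printing Implicit Defensive.

Import Order.TTheory GRing.Theory Num.Theory.
Import numFieldNormedType.Exports.
Import ComplexField.Normc.

Local Open Scope ring_scope.
Local Open Scope classical_set_scope.

(* MathComp-Analysis only equips the alias R[i]^o with the topology induced by
   the modulus; it is transported here to R[i] itself. *)
HB.instance Definition _ (R : realType) := NormedModule.copy R[i] R[i]^o.

Section Touchard.

Definition stirling2 (F : fieldType) (m k : nat) : F :=
  (k`!%:R)^-1 *
  \sum_(0 <= i < k.+1) (-1) ^+ i * 'C(k, i)%:R * ((k - i)%N%:R) ^+ m.

Definition touchard (F : fieldType) (m : nat) : {poly F} :=
  \poly_(k < m.+1) stirling2 F m k.

Variable R : realType.

Definition cexp (z : R[i]) : R[i] :=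
  limn (series (fun k : nat => z ^+ k / k`!%:R)).

Definition touchard_quotient (p : nat) (x : R[i]) : R[i] :=
  x^-1 * (touchard R[i] (2 * p + 1)).[x] * cexp x.

Definition touchard_kernel (p : nat) (z w : R[i]) : R[i] :=
  let x := z * (w^*)%C in
  if x == 0 then lim (touchard_quotient p y @[y --> (0 : R[i])^'])
  else touchard_quotient p x.

Definition has_power_series (f : R[i] -> R[i]) (a : nat -> R[i]) : Prop :=
  forall z, series (fun m : nat => a m * z ^+ m) @ \oo --> f z.

(* The coefficients of an everywhere convergent power series are unique, so the
   choice made by xget is the only possible one. *)
Definition power_series_coef (f : R[i] -> R[i]) : nat -> R[i] :=
  xget (fun=> 0) [set a | has_power_series f a].

Definition Hp_weighted (p : nat) (a : nat -> R[i]) : R^nat :=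
  fun m => normc (a m) ^+ 2 * m`!%:R / (m.+1)%:R ^+ (2 * p).

Definition Hp (p : nat) : set (R[i] -> R[i]) :=
  [set f | exists a, has_power_series f a /\ cvgn (series (Hp_weighted p a))].

Definition Hp_norm2 (p : nat) (f : R[i] -> R[i]) : R :=
  limn (series (Hp_weighted p (power_series_coef f))).

Definition posdefmx (n : nat) (A : 'M[R[i]]_n) : Prop :=
  (forall k j, A k j = (A j k)^*%C) /\
  (forall c : 'I_n -> R[i], (exists k, c k != 0) ->
     0 < \sum_k \sum_j (c k)^*%C * A k j * c j).

Definition node (n : nat) (h : 'I_n.+1 -> R) (j : 'I_n.+1) : R[i] :=
  - 'i%C * ((h j)%:C)%C.

Definition touchard_gram (p n : nat) (z : 'I_n.+1 -> R[i]) : 'M[R[i]]_n.+1 :=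
  \matrix_(k, j) touchard_kernel p (z k) (z j).

Definition touchard_superoscillation (p n : nat) (h : 'I_n.+1 -> R)
    (Z : 'I_n.+1 -> R[i]) (z : R[i]) : R[i] :=
  \sum_j Z j * touchard_kernel p z (node h j).

Definition regularized_risk (p n : nat) (lambda : R) (z w : 'I_n.+1 -> R[i])
    (f : R[i] -> R[i]) : R :=
  \sum_k normc (w k - f (z k)) ^+ 2 + lambda * Hp_norm2 p f.

End Touchard.

Definition is_minimizer (R : realType) (T : Type) (H : set T) (J : T -> R)
    (f : T) : Prop :=
  H f /\ forall g, H g -> J f <= J g.

Definition is_the_minimizer (R : realType) (T : Type) (H : set T) (J : T -> R)
    (f : T) : Prop :=
  is_minimizer H J f /\ forall g, is_minimizer H J g -> g = f.

(* Main.v *)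
Require Import Defs.
From HB Require Import structures.
From mathcomp Require Import all_boot all_order all_algebra.
From mathcomp Require Import complex.
From mathcomp Require Import all_classical all_reals all_analysis.
From mathcomp Require Import ring lra.

Set Implicit Arguments.
Unset Strict Implicit.
Unset Printing Implicit Defensive.

Import Order.TTheory GRing.Theory Num.Theory.
Import numFieldNormedType.Exports.
Import ComplexField.Normc.

Local Open Scope ring_scope.

(** This is kernel ridge regression in H_p(C).  Write F = sum_j Z_j K(., z_j)
    and e_k = lambda Z_k - (w_k - F(z_k)).  The reproducing property
    <d, F> = sum_j conj(Z_j) d(z_j) turns the expansion of the two squares in
    J(F + d) into
<<
      J(F + d) - J(F) = sum_k |d(z_k)|^2 + lambda ||d||^2
                        + 2 Re (sum_k conj(e_k) d(z_k))
>>
    for every d in H_p (risk_expansion).  The weight condition says exactly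
    that e = 0.  If e = 0, the increment is at least lambda ||d||^2, which is
    positive unless d = 0, so that F is the only minimizer
    (kernel_comb_is_minimizer).  If F is a minimizer, the increment along
    d = - t sum_j e_j K(., z_j) equals A t^2 - 2 t e^* G e, where G is the Gram
    matrix; it is negative for small t > 0 unless e^* G e = 0, and G is
    positive definite, so that e = 0 (minimizer_weights).

    The reproducing property needs no Hilbert space theory.  It comes down to
    the expansion K_p(z, w) = sum_m (m+1)^(2p) / m! (z conj(w))^m
    (has_sum_kernel): the coefficients of K_p(., w) cancel the weights of the
    norm, so that the series of <f, K_p(., w)> is, term by term, the power
    series of f at w, and its convergence is part of the assumption on f.  The
    expansion is Dobinski's formula T_m(x) e^x = sum_k k^m x^k / k!
    (has_sum_touchard) for m = 2p + 1, divided by x; the value at x = 0 is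
    obtained from the continuity at 0 of a convergent power series
    (power_series_near0).  The norm of H_p is defined through the coefficients
    of a function; it is well defined because these coefficients are unique
    (power_series_coefE). *)

(** * Convergence of complex series through real and imaginary parts *)

Section ComplexSeries.
Local Open Scope classical_set_scope.
Variable R : realType.
Implicit Types (a b : nat -> R[i]) (x y z s t : R[i]).

Lemma ReD x y : complex.Re (x + y) = complex.Re x + complex.Re y.
Proof. by case: x y => [? ?] [? ?]. Qed.
Lemma ImD x y : complex.Im (x + y) = complex.Im x + complex.Im y.
Proof. by case: x y => [? ?] [? ?]. Qed.
Lemma ReM x y : complex.Re (x * y) = complex.Re x * complex.Re y - complex.Im x * complex.Im y.
Proof. by case: x y => [? ?] [? ?]. Qed.
Lemma ImM x y : complex.Im (x * y) = complex.Re x * complex.Im y + complex.Im x * complex.Re y.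
Proof. by case: x y => [? ?] [? ?]. Qed.

Lemma Re_sum (I : Type) (r : seq I) (P : pred I) (F : I -> R[i]) :
  complex.Re (\sum_(i <- r | P i) F i) = \sum_(i <- r | P i) complex.Re (F i).
Proof. exact: (big_morph _ ReD). Qed.
Lemma Im_sum (I : Type) (r : seq I) (P : pred I) (F : I -> R[i]) :
  complex.Im (\sum_(i <- r | P i) F i) = \sum_(i <- r | P i) complex.Im (F i).
Proof. exact: (big_morph _ ImD). Qed.

Lemma normC_normc x : `|x| = ((normc x)%:C)%C.
Proof. by []. Qed.

Lemma normc_ge0 x : 0 <= normc x.
Proof. by case: x => ? ? /=; rewrite sqrtr_ge0. Qed.

Lemma normc_sqr x : normc x ^+ 2 = complex.Re x ^+ 2 + complex.Im x ^+ 2.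
Proof. by case: x => u v /=; rewrite sqr_sqrtr // addr_ge0 // sqr_ge0. Qed.

Lemma Re_le_normc x : `|complex.Re x| <= normc x.
Proof.
rewrite -(ler_pXn2r (n := 2)) ?nnegrE ?normc_ge0 // real_normK ?num_real //.
by rewrite normc_sqr lerDl sqr_ge0.
Qed.
Lemma Im_le_normc x : `|complex.Im x| <= normc x.
Proof.
rewrite -(ler_pXn2r (n := 2)) ?nnegrE ?normc_ge0 // real_normK ?num_real //.
by rewrite normc_sqr lerDr sqr_ge0.
Qed.
Lemma normc_le_ReIm x : normc x <= `|complex.Re x| + `|complex.Im x|.
Proof.
rewrite -(ler_pXn2r (n := 2)) ?nnegrE ?normc_ge0 ?addr_ge0 //.
rewrite normc_sqr sqrrD !real_normK ?num_real //.
have := mulr_ge0 (normr_ge0 (complex.Re x)) (normr_ge0 (complex.Im x)); lra.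
Qed.

Lemma normc_triangle x y : normc (x + y) <= normc x + normc y.
Proof. by have := ler_normD x y; rewrite !normC_normc -raddfD lecR. Qed.

Lemma normc_sum (I : Type) (r : seq I) (P : pred I) (F : I -> R[i]) :
  normc (\sum_(i <- r | P i) F i) <= \sum_(i <- r | P i) normc (F i).
Proof.
elim/big_rec2: _ => [|i u v _ h]; first by rewrite normc0.
exact: le_trans (normc_triangle _ _) (lerD _ h).
Qed.

Lemma normcX x n : normc (x ^+ n) = normc x ^+ n.
Proof. by elim: n => [|n IH]; rewrite ?expr0 ?normc1 // !exprS normcM IH. Qed.

Lemma normc_nat n : normc (n%:R : R[i]) = n%:R.
Proof.
have : `|n%:R : R[i]| = n%:R by rewrite ger0_norm // ler0n.
by rewrite normC_normc -(rmorph_nat (@real_complex R)) => /complexI.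
Qed.

Lemma gt0_realC x : 0 < x -> x = ((complex.Re x)%:C)%C /\ 0 < complex.Re x.
Proof. by case: x => u v; rewrite ltcE /= => /andP[/eqP ->]. Qed.

(** All limits in R[i] are reduced to limits in R, where completeness and the
    algebra of limits apply. *)
Lemma cvg_ReImP (u : nat -> R[i]) s : u @ \oo --> s <->
  ((fun n => complex.Re (u n)) @ \oo --> complex.Re s /\
   (fun n => complex.Im (u n)) @ \oo --> complex.Im s).
Proof.
have ReB x y : complex.Re (x - y) = complex.Re x - complex.Re y.
  by case: x y => [? ?] [? ?].
have ImB x y : complex.Im (x - y) = complex.Im x - complex.Im y.
  by case: x y => [? ?] [? ?].
split=> [/cvgrPdist_lt H|[/cvgrPdist_lt HR /cvgrPdist_lt HI]].
  split; apply/cvgrPdist_lt => e e0; have := H (e%:C)%C.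
    rewrite ltcR => /(_ e0); apply: filterS => n.
    rewrite normC_normc ltcR -ReB; apply: le_lt_trans; exact: Re_le_normc.
  rewrite ltcR => /(_ e0); apply: filterS => n.
  rewrite normC_normc ltcR -ImB; apply: le_lt_trans; exact: Im_le_normc.
apply/cvgrPdist_lt => e e0.
have [eE e0R] := gt0_realC e0.
have e2 : 0 < complex.Re e / 2 by rewrite divr_gt0.
near=> n; rewrite eE normC_normc ltcR.
apply: le_lt_trans (normc_le_ReIm _) _; rewrite ReB ImB [ltRHS]splitr.
apply: ltrD; near: n; [exact: HR|exact: HI].
Unshelve. all: by end_near.
Qed.

(** The wrapper keeps the filter inclusion hidden in [-->] from being unfolded
    by unification and by the inference of implicit arguments. *)
Variant has_sum a s : Prop := HasSum of series a @ \oo --> s.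

Lemma has_sumP a s : has_sum a s <-> series a @ \oo --> s.
Proof. by split=> [[]|]. Qed.

Lemma has_sum_ReImP a s : has_sum a s <->
  (series (fun n => complex.Re (a n)) @ \oo --> complex.Re s /\
   series (fun n => complex.Im (a n)) @ \oo --> complex.Im s).
Proof.
rewrite has_sumP cvg_ReImP.
have -> : (fun n => complex.Re (series a n)) = series (fun n => complex.Re (a n)).
  by apply/funext => n; rewrite /series /= Re_sum.
have -> // : (fun n => complex.Im (series a n)) = series (fun n => complex.Im (a n)).
by apply/funext => n; rewrite /series /= Im_sum.
Qed.

Lemma has_sum_Re a s : has_sum a s ->
  series (fun n => complex.Re (a n)) @ \oo --> complex.Re s.
Proof. by case/has_sum_ReImP. Qed.

Lemma has_sum_unique a s t : has_sum a s -> has_sum a t -> s = t.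
Proof. by move=> [h] [k]; exact: (cvg_unique _ h k). Qed.

Lemma has_sum_ext a b s : a =1 b -> has_sum a s -> has_sum b s.
Proof. by move=> /funext ->. Qed.

Lemma has_sumD a b s t :
  has_sum a s -> has_sum b t -> has_sum (fun n => a n + b n) (s + t).
Proof.
move=> /has_sum_ReImP[ar ai] /has_sum_ReImP[br bi]; apply/has_sum_ReImP.
rewrite ReD ImD; split.
  rewrite [X in X @ _](_ : _ = series (fun n => complex.Re (a n)) +
    series (fun n => complex.Re (b n))); first exact: cvgD.
  apply/funext => n; rewrite /series /= fctE -big_split /=.
  by apply: eq_bigr => ? _; rewrite ReD.
rewrite [X in X @ _](_ : _ = series (fun n => complex.Im (a n)) +
  series (fun n => complex.Im (b n))); first exact: cvgD.
apply/funext => n; rewrite /series /= fctE -big_split /=.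
by apply: eq_bigr => ? _; rewrite ImD.
Qed.

Lemma has_sumMl c a s : has_sum a s -> has_sum (fun n => c * a n) (c * s).
Proof.
move=> /has_sum_ReImP[ar ai]; apply/has_sum_ReImP.
rewrite ReM ImM; split.
  rewrite [X in X @ _](_ : _ =
    (fun n => complex.Re c * series (fun n => complex.Re (a n)) n -
              complex.Im c * series (fun n => complex.Im (a n)) n)).
    by apply: cvgB; apply: cvgMl_tmp.
  apply/funext => n; rewrite /series /= !mulr_sumr -sumrB.
  by apply: eq_bigr => k _; rewrite ReM.
rewrite [X in X @ _](_ : _ =
  (fun n => complex.Re c * series (fun n => complex.Im (a n)) n +
            complex.Im c * series (fun n => complex.Re (a n)) n)).
  by apply: cvgD; apply: cvgMl_tmp.
apply/funext => n; rewrite /series /= !mulr_sumr -big_split /=.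
by apply: eq_bigr => k _; rewrite ImM.
Qed.

Lemma has_sum0 : has_sum (fun=> 0) 0.
Proof.
rewrite has_sumP (_ : series _ = fun=> 0); first exact: cvg_cst.
by apply/funext => n; rewrite /series /= big1.
Qed.

Lemma has_sum_bigsum (I : Type) (r : seq I) (F : I -> nat -> R[i]) (S : I -> R[i]) :
  (forall i, has_sum (F i) (S i)) ->
  has_sum (fun n => \sum_(i <- r) F i n) (\sum_(i <- r) S i).
Proof.
move=> h; elim: r => [|i r IH].
  by rewrite big_nil; apply: has_sum_ext has_sum0 => n; rewrite big_nil.
rewrite big_cons; apply: has_sum_ext (has_sumD (h i) IH) => n.
by rewrite big_cons.
Qed.

Lemma has_sum_shift a s : has_sum (fun n => a n.+1) s <-> has_sum a (a 0%N + s).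
Proof.
have key (u : nat -> R) (l : R) : series (fun n => u n.+1) @ \oo --> l <->
    series u @ \oo --> u 0%N + l.
  have E n : series u n.+1 = u 0%N + series (fun n => u n.+1) n.
    by rewrite /series /= big_nat_recl.
  rewrite -(cvg_shiftS (series u)); split=> h.
    by under eq_fun do rewrite E; apply: cvgD => //; apply: cvg_cst.
  have -> : series (fun n => u n.+1) = (fun n => series u n.+1 - u 0%N).
    by apply/funext => n; rewrite E addrAC subrr add0r.
  rewrite (_ : l = u 0%N + l - u 0%N); last by rewrite addrAC subrr add0r.
  by apply: cvgB => //; apply: cvg_cst.
rewrite !has_sum_ReImP ReD ImD.
by rewrite (key (fun n => complex.Re (a n))) (key (fun n => complex.Im (a n))).
Qed.

Lemma has_sum_shift0 a s : a 0%N = 0 -> has_sum (fun n => a n.+1) s <-> has_sum a s.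
Proof. by move=> a0; rewrite has_sum_shift a0 add0r. Qed.

(** Absolute convergence: the real and imaginary parts are dominated by the
    modulus, and R is complete. *)
Lemma has_sum_normc a : cvgn (series (fun n => normc (a n))) -> exists s, has_sum a s.
Proof.
move=> h.
have key (u : nat -> R) : (forall n, `|u n| <= normc (a n)) -> cvgn (series u).
  move=> le; apply: normed_cvg; apply: series_le_cvg h => [n|n|n];
    [exact: normr_ge0|exact: normc_ge0|exact: le].
have /cvg_ex[x hx] := key _ (fun n => Re_le_normc (a n)).
have /cvg_ex[y hy] := key _ (fun n => Im_le_normc (a n)).
by exists (Complex x y); apply/has_sum_ReImP.
Qed.

Lemma has_sum_bounded a s : has_sum a s -> exists2 M, 0 < M & forall n, normc (a n) <= M.
Proof.
move=> /has_sum_ReImP[ar ai].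
have key (u : nat -> R) (l : R) : series u @ \oo --> l -> exists M, forall n, `|u n| <= M.
  move=> h; have : cvgn (series u) by apply/cvg_ex; exists l.
  move/cvg_series_cvg_0/(cvgP 0)/cvg_seq_bounded => [M [_ hM]].
  by exists (M + 1) => n; apply: hM => //; rewrite ltrDl.
have [M hM] := key _ _ ar; have [N hN] := key _ _ ai.
have M0 : 0 <= M by apply: le_trans (hM 0%N).
have N0 : 0 <= N by apply: le_trans (hN 0%N).
exists (M + N + 1); first by rewrite ltr_wpDl ?addr_ge0.
move=> n; apply: le_trans (normc_le_ReIm _) _; apply: ler_wpDr => //.
exact: lerD.
Qed.

Lemma normc_has_sum_le a s (B : R) :
  has_sum a s -> (forall n, normc (series a n) <= B) -> normc s <= B.
Proof.
move=> [/cvgrPdist_lt h] hB; apply/ler_addgt0Pr => e e0.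
have : 0 < (e%:C)%C by rewrite ltcR.
move=> /h [N _ /(_ N (leqnn N))]; rewrite normC_normc ltcR => hN.
have -> : s = (s - series a N) + series a N by rewrite subrK.
by apply: le_trans (normc_triangle _ _) _; rewrite addrC lerD // ltW.
Qed.

End ComplexSeries.

(** * Stirling numbers of the second kind *)

Section Stirling.
Variable F : numFieldType.

(** For k > 0 the alternating sum is the binomial expansion of (1 - 1)^k. *)
Lemma stirling2_0 k : stirling2 F 0 k = (k == 0%N)%:R.
Proof.
rewrite /stirling2; case: k => [|k].
  by rewrite big_nat1 bin0 subnn !expr0 !mulr1 fact0 invr1.
rewrite big_mkord; under eq_bigr do rewrite expr0 mulr1.
have := exprDn (1 : F) (-1) k.+1; rewrite subrr expr0n /= => h.
transitivity ((k.+1`!%:R : F)^-1 * 0); last by rewrite mulr0.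
congr (_ * _); apply: etrans (esym h).
by apply: eq_bigr => i _; rewrite expr1n mul1r mulr_natr.
Qed.

Lemma stirling2_S0 m : stirling2 F m.+1 0 = 0.
Proof. by rewrite /stirling2 big_nat1 subnn expr0n /= !mulr0. Qed.

(** Up to the factor k!, the explicit formula is the k-th difference at 0 of
    i |-> i^m; the recurrence combines the absorption identity
    (k+1) 'C(k, i) = (k+1-i) 'C(k+1, i) with Pascal's rule. *)
Lemma stirling2_SS m k :
  stirling2 F m.+1 k.+1 = k.+1%:R * stirling2 F m k.+1 + stirling2 F m k.
Proof.
pose D q j : F := \sum_(0 <= i < j.+1) (-1) ^+ i * 'C(j, i)%:R * ((j - i)%N%:R) ^+ q.
have D_S : D m.+1 k.+1 = k.+1%:R * (D m k.+1 + D m k).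
  transitivity (k.+1%:R * \sum_(0 <= i < k.+2)
      (-1) ^+ i * 'C(k, i)%:R * ((k.+1 - i)%N%:R : F) ^+ m).
    rewrite mulr_sumr; apply: eq_bigr => i _.
    rewrite exprS [in RHS]mulrA [in RHS]mulrCA -natrM (mul_bin_down k.+1 i) natrM.
    ring.
  congr (_ * _); rewrite /D [in LHS]big_nat_recl // [in RHS]big_nat_recl //.
  rewrite !bin0 -addrA; congr (_ + _); rewrite -big_split /=.
  by apply: eq_bigr => i _; rewrite binS natrD subSS exprS; ring.
rewrite /stirling2 -/(D m.+1 k.+1) -/(D m k.+1) -/(D m k) D_S factS natrM.
have k0 : k`!%:R != 0 :> F by rewrite pnatr_eq0 -lt0n fact_gt0.
have k1 : 1 + k%:R != 0 :> F by rewrite addrC natr1 pnatr_eq0.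
by field; rewrite k0 k1.
Qed.

Lemma stirling2_small m k : (m < k)%N -> stirling2 F m k = 0.
Proof.
elim: m k => [|m IH] [|k] //; first by rewrite stirling2_0.
by rewrite ltnS => mk; rewrite stirling2_SS !IH ?mulr0 ?addr0 // ltnW.
Qed.

(** Change of basis from powers to falling factorials, by induction on m:
    k * k^_j = k^_(j+1) + j * k^_j reproduces the recurrence of the Stirling
    numbers. *)
Lemma expn_ffact m k :
  (k%:R : F) ^+ m = \sum_(j < m.+1) stirling2 F m j * (k ^_ j)%:R.
Proof.
have kff j : k%:R * (k ^_ j)%:R = (k ^_ j.+1)%:R + j%:R * (k ^_ j)%:R :> F.
  rewrite ffactnSr -!natrM -natrD; congr _%:R.
  have [jk|kj] := leqP j k; last by rewrite ffact_small // !muln0.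
  by rewrite [X in (X + _)%N]mulnC -mulnDl subnK.
elim: m => [|m IH]; first by rewrite big_ord1 stirling2_0 mul1r ffactn0.
rewrite exprS IH mulr_sumr.
under eq_bigr do rewrite mulrCA kff mulrDr.
rewrite big_split /= [RHS]big_ord_recl stirling2_S0 mul0r add0r.
under [RHS]eq_bigr do rewrite stirling2_SS mulrDl.
rewrite [RHS]big_split /= addrC; congr (_ + _).
(* The extra term vanishes since S(m, m+1) = 0. *)
have -> : \sum_(i < m.+1) stirling2 F m i * (i%:R * (k ^_ i)%:R) =
    \sum_(i < m.+2) stirling2 F m i * (i%:R * (k ^_ i)%:R).
  by rewrite [RHS]big_ord_recr /= stirling2_small // mul0r addr0.
rewrite big_ord_recl mul0r mulr0 add0r; apply: eq_bigr => i _.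
by rewrite mulrCA mulrA.
Qed.

End Stirling.

(** * Dobinski's formula *)

Section Kernel.
Local Open Scope classical_set_scope.
Variable R : realType.
Implicit Types (a b : nat -> R[i]) (x y z s t : R[i]).

Lemma fact_neq0 n : (n`!%:R : R[i]) != 0.
Proof. by rewrite pnatr_eq0 -lt0n fact_gt0. Qed.

Lemma has_sum_cexp z : has_sum (fun k => z ^+ k / k`!%:R) (cexp z).
Proof.
have [|s hs] := @has_sum_normc R (fun k => z ^+ k / k`!%:R).
  rewrite [X in cvgn (series X)](_ : _ = exp_coeff (normc z)).
    exact: is_cvg_series_exp_coeff.
  by apply/funext => k; rewrite normcM normcV normcX normc_nat.
suff -> : cexp z = s by [].
by apply: (@cvg_lim R[i]) => //; apply/has_sumP.
Qed.

(** The generating series of the falling factorials, shifted down one step at a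
    time: (k+1)^_(j+1) / (k+1)! = k^_j / k!. *)
Lemma has_sum_ffact j z :
  has_sum (fun k => (k ^_ j)%:R * (z ^+ k / k`!%:R)) (z ^+ j * cexp z).
Proof.
elim: j => [|j IH].
  by rewrite mul1r; apply: has_sum_ext (has_sum_cexp z) => k; rewrite mul1r.
apply/has_sum_shift0; first by rewrite mul0r.
rewrite exprS -mulrA; apply: has_sum_ext (has_sumMl z IH) => k.
rewrite ffactSS factS !natrM exprS.
have k1 : 1 + k%:R != 0 :> R[i] by rewrite addrC natr1 pnatr_eq0.
by field; rewrite fact_neq0 k1.
Qed.

(** Dobinski's formula; its left-hand side is a finite combination of the
    falling factorial series, so that no rearrangement is involved. *)
Lemma has_sum_touchard m z :
  has_sum (fun k => k%:R ^+ m * (z ^+ k / k`!%:R)) ((touchard R[i] m).[z] * cexp z).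
Proof.
rewrite horner_poly mulr_suml.
have := has_sum_bigsum (index_enum 'I_m.+1)
  (fun j : 'I_m.+1 => has_sumMl (stirling2 R[i] m j) (has_sum_ffact j z)).
under [X in has_sum _ X]eq_bigr do rewrite mulrA.
apply: has_sum_ext => k; rewrite (expn_ffact R[i]) mulr_suml.
by apply: eq_bigr => j _; rewrite mulrA.
Qed.

(** The Taylor coefficients of K_p as a function of z conj(w). *)
Definition kernel_coef p m : R[i] := m.+1%:R ^+ (2 * p) / m`!%:R.

(** In Dobinski's formula for the exponent 2p + 1 the term k = 0 vanishes, and
    k^(2p+1) / k! = k^(2p) / (k-1)! for k > 0. *)
Lemma has_sum_touchard_quotient p z : z != 0 ->
  has_sum (fun m => kernel_coef p m * z ^+ m) (touchard_quotient p z).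
Proof.
move=> z0; have := has_sum_touchard (2 * p + 1) z.
rewrite -has_sum_shift0; last by rewrite addn1 exprS !mul0r.
move/(has_sumMl z^-1); rewrite mulrA; apply: has_sum_ext => k.
rewrite /kernel_coef factS natrM exprS exprD expr1.
have k1 : 1 + k%:R != 0 :> R[i] by rewrite addrC natr1 pnatr_eq0.
by field; rewrite fact_neq0 z0 k1.
Qed.

End Kernel.

(** * Power series near the origin and the expansion of the kernel *)

Section PowerSeries.
Local Open Scope classical_set_scope.
Variable R : realType.
Implicit Types (a b : nat -> R[i]) (f : R[i] -> R[i]) (x y z s t : R[i]).

Lemma has_power_seriesP f a :
  has_power_series f a <-> forall z, has_sum (fun m => a m * z ^+ m) (f z).
Proof. by split=> h z; apply/has_sumP. Qed.

Lemma sum_geom_le2 (r : R) n : 0 <= r -> r <= 1 / 2 ->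
  \sum_(0 <= k < n) r ^+ k <= 2.
Proof.
move=> r0 r1; elim: n => [|n IH]; first by rewrite big_nil.
rewrite big_nat_recl // expr0.
under eq_bigr do rewrite exprS.
rewrite -mulr_sumr; have := ler_wpM2l r0 IH; lra.
Qed.

(** Convergence at 1 bounds the coefficients, and the tail is dominated by a
    geometric series of ratio at most 1/2.  This Lipschitz bound yields both
    the continuous extension of the kernel and the uniqueness of the
    coefficients. *)
Lemma power_series_near0 a t : has_sum a t ->
  exists2 M, 0 < M & forall z s, normc z <= 1 / 2 ->
    has_sum (fun m => a m * z ^+ m) s -> normc (s - a 0%N) <= M * normc z.
Proof.
move=> /has_sum_bounded[M M0 aM]; exists (M * 2); first by rewrite mulr_gt0.
move=> z s z2 hs.
have /normc_has_sum_le : has_sum (fun m => a m.+1 * z ^+ m.+1) (s - a 0%N).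
  apply/(has_sum_shift (fun m => a m * z ^+ m)).
  by rewrite /= expr0 mulr1 addrCA subrr addr0.
apply=> n; apply: le_trans (normc_sum _ _ _) _.
apply: (@le_trans _ _ (\sum_(0 <= k < n) (M * normc z) * normc z ^+ k)).
  apply: ler_sum => k _; rewrite normcM normcX exprS [leRHS]mulrAC -!mulrA.
  rewrite [normc z ^+ k * _]mulrC.
  by apply: ler_wpM2r; rewrite ?aM // mulr_ge0 ?normc_ge0 ?exprn_ge0 ?normc_ge0.
rewrite -mulr_sumr [leRHS]mulrAC; apply: ler_wpM2l.
  by rewrite mulr_ge0 ?normc_ge0 // ltW.
by apply: sum_geom_le2 => //; exact: normc_ge0.
Qed.

Lemma has_sum_at0 a : has_sum (fun m => a m * 0 ^+ m) (a 0%N).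
Proof.
rewrite -[X in has_sum _ X]addr0.
have := has_sum_shift (fun m => a m * 0 ^+ m) 0; rewrite /= expr0 mulr1 => <-.
by apply: has_sum_ext (has_sum0 R) => m; rewrite exprS mul0r mulr0.
Qed.

(** The value at 0 gives a_0 = 0; division by z then gives a series with the
    coefficients a_(m+1) whose sum is 0 except perhaps at 0, hence also at 0 by
    continuity, and the argument can be repeated. *)
Lemma power_series_eq0 a :
  (forall z, has_sum (fun m => a m * z ^+ m) 0) -> forall m, a m = 0.
Proof.
have a0 b : (forall z, has_sum (fun m => b m * z ^+ m) 0) -> b 0%N = 0.
  move=> h; exact: has_sum_unique (has_sum_at0 b) (h 0).
suff step b : (forall z, has_sum (fun m => b m * z ^+ m) 0) ->
    forall z, has_sum (fun m => b m.+1 * z ^+ m) 0.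
  move=> h m; elim: m a h => [|m IH] a h; first exact: a0.
  by apply: (IH (fun m => a m.+1)); exact: step.
move=> h.
have hS z : z != 0 -> has_sum (fun m => b m.+1 * z ^+ m) 0.
  move=> z0; have := h z; rewrite -has_sum_shift0; last by rewrite a0 // mul0r.
  move/(has_sumMl z^-1); rewrite mulr0; apply: has_sum_ext => m.
  by rewrite exprS; field.
suff b1 : b 1%N = 0.
  move=> z; have [->|] := eqVneq z 0; last exact: hS.
  by rewrite -[X in has_sum _ X]b1; exact: (has_sum_at0 (fun m => b m.+1)).
have h1 : has_sum (fun m => b m.+1) 0.
  by apply: has_sum_ext (hS 1 (oner_neq0 _)) => m; rewrite expr1n mulr1.
have [M M0 hM] := power_series_near0 h1.
apply: eq0_normc; apply/eqP; rewrite -[_ == 0]negbK; apply/negP => b1.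
have b1_gt0 : 0 < normc (b 1%N) by rewrite lt_neqAle eq_sym b1 normc_ge0.
(* At this point r the bound reads |b_1| <= M r <= |b_1| / 2. *)
pose r : R := Num.min (1 / 2) (normc (b 1%N) / (2 * M)).
have r0 : 0 < r by rewrite lt_min !divr_gt0 // mulr_gt0.
have nr : normc ((r%:C)%C) = r.
  by apply: complexI; rewrite -normC_normc ger0_norm // ler0c ltW.
have := hM ((r%:C)%C) 0; rewrite nr => /(_ _ (hS _ _)).
rewrite sub0r.
have -> : normc (- b 1%N) = normc (b 1%N).
  by apply: complexI; rewrite -!normC_normc normrN.
have rz : ((r%:C)%C : R[i]) != 0 by rewrite (inj_eq (@complexI _) r 0) gt_eqF.
have r2 : r <= 1 / 2 by rewrite ge_min lexx.
move=> /(_ r2 rz).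
have rM : r <= normc (b 1%N) / (2 * M) by rewrite ge_min lexx orbT.
move: rM; rewrite ler_pdivlMr ?mulr_gt0 // => rM.
by rewrite leNgt => /negP; apply; nra.
Qed.

Lemma power_series_coefE f a : has_power_series f a -> power_series_coef f = a.
Proof.
move=> fa; apply: xget_unique => // b fb.
apply/funext => m; apply/eqP; rewrite -subr_eq0; apply/eqP.
apply: (power_series_eq0 (a := fun m => b m - a m)) => z.
have /has_power_seriesP/(_ z) ha := fa; have /has_power_seriesP/(_ z) hb := fb.
have := has_sumD hb (has_sumMl (-1) ha); rewrite mulN1r subrr.
by apply: has_sum_ext => k; rewrite mulN1r mulrBl.
Qed.

Lemma kernel_coef0 p : kernel_coef R p 0 = 1.
Proof. by rewrite /kernel_coef expr1n fact0 divr1. Qed.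

Lemma touchard_quotient_lim0 p :
  lim (touchard_quotient p y @[y --> (0 : R[i])^']) = 1.
Proof.
apply: (@cvg_lim R[i]) => //.
have h1 : has_sum (kernel_coef R p) (touchard_quotient p 1).
  apply: has_sum_ext (has_sum_touchard_quotient p (oner_neq0 _)) => m.
  by rewrite expr1n mulr1.
have [M M0 hM] := power_series_near0 h1.
apply/cvgrPdist_lt => e e0.
have [eE e0R] := gt0_realC e0.
pose d : R := Num.min (1 / 2) (complex.Re e / M).
have d0 : 0 < (d%:C)%C :> R[i] by rewrite ltcR lt_min !divr_gt0.
near=> y.
have y0 : y != 0 by near: y; exact: nbhs_dnbhs_neq.
have : `|y| < (d%:C)%C by near: y; exact: dnbhs0_lt.
rewrite normC_normc ltcR lt_min => /andP[y2 yM].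
rewrite distrC eE normC_normc ltcR -(kernel_coef0 p).
apply: le_lt_trans (hM y _ (ltW y2) (has_sum_touchard_quotient p y0)) _.
by rewrite mulrC -ltr_pdivlMr.
Unshelve. all: by end_near.
Qed.

(** The extension by continuity of the kernel has the same expansion, so the two
    cases of its definition need no distinction below. *)
Lemma has_sum_kernel p z w :
  has_sum (fun m => kernel_coef R p m * (z * (w^*)%C) ^+ m) (touchard_kernel p z w).
Proof.
rewrite /touchard_kernel; have [->|x0] := eqVneq (z * (w^*)%C) 0.
  rewrite touchard_quotient_lim0 -(kernel_coef0 p); exact: has_sum_at0.
exact: has_sum_touchard_quotient.
Qed.

End PowerSeries.

(** * The space H_p and its reproducing property *)

Section Hilbert.
Local Open Scope classical_set_scope.
Variable R : realType.
Implicit Types (a b : nat -> R[i]) (f g : R[i] -> R[i]) (x y s t : R[i]).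

Lemma normc_sqrD x y :
  normc (x + y) ^+ 2 = normc x ^+ 2 + normc y ^+ 2 + 2 * complex.Re ((y^*)%C * x).
Proof. by rewrite !normc_sqr; case: x y => [? ?] [? ?] /=; ring. Qed.

Lemma normc_sqrB x y :
  normc (x - y) ^+ 2 = normc x ^+ 2 + normc y ^+ 2 - 2 * complex.Re ((x^*)%C * y).
Proof. by rewrite !normc_sqr; case: x y => [? ?] [? ?] /=; ring. Qed.

Lemma Re_conjM x : complex.Re ((x^*)%C * x) = normc x ^+ 2.
Proof. by rewrite normc_sqr; case: x => [? ?] /=; ring. Qed.

Lemma ReMl (c : R) x : complex.Re ((c%:C)%C * x) = c * complex.Re x.
Proof. by case: x => [? ?] /=; ring. Qed.

Lemma cvg_series_sqrD (u v q : nat -> R) (k l r : R) :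
  series u @ \oo --> k -> series v @ \oo --> l -> series q @ \oo --> r ->
  series (fun m => u m + v m + 2 * q m) @ \oo --> k + l + 2 * r.
Proof.
move=> uk vl qr.
rewrite (_ : series _ = (fun n => series u n + series v n + 2 * series q n)).
  by apply: cvgD; [exact: cvgD|exact: cvgMl_tmp].
by apply/funext => n; rewrite /series /= mulr_sumr -!big_split.
Qed.

Definition weight p m : R := m`!%:R / m.+1%:R ^+ (2 * p).

Lemma weight_gt0 p m : 0 < weight p m.
Proof. by rewrite divr_gt0 ?exprn_gt0 // ltr0n fact_gt0. Qed.

Lemma kernel_coefE p m : kernel_coef R p m = (((weight p m)^-1)%:C)%C.
Proof. by rewrite invf_div rmorphM fmorphV rmorphXn !rmorph_nat. Qed.

Lemma Hp_weightedE p a m : Hp_weighted p a m = weight p m * normc (a m) ^+ 2.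
Proof. by rewrite /Hp_weighted /weight -mulrA mulrC. Qed.

Lemma Hp_weighted_ge0 p a m : 0 <= Hp_weighted p a m.
Proof. by rewrite Hp_weightedE mulr_ge0 ?sqr_ge0 // ltW ?weight_gt0. Qed.

Lemma HpP p f a (N : R) : has_power_series f a ->
  series (Hp_weighted p a) @ \oo --> N -> Hp p f /\ Hp_norm2 p f = N.
Proof.
move=> fa aN; split; first by exists a; split => //; apply/cvg_ex; exists N.
by rewrite /Hp_norm2 (power_series_coefE fa); exact: cvg_lim.
Qed.

Lemma Hp_coef p f : Hp p f -> exists2 a, has_power_series f a &
  series (Hp_weighted p a) @ \oo --> Hp_norm2 p f.
Proof. by move=> [a [fa ca]]; exists a => //; rewrite /Hp_norm2 (power_series_coefE fa). Qed.

Lemma Hp_norm2_ge0 p f : Hp p f -> 0 <= Hp_norm2 p f.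
Proof.
move=> /Hp_coef[a _ ca]; rewrite -(cvg_lim _ ca) //; apply: limr_ge.
  by apply/cvg_ex; exists (Hp_norm2 p f).
by near=> n; apply: sumr_ge0 => m _; exact: Hp_weighted_ge0.
Unshelve. all: by end_near.
Qed.

Lemma Hp_norm2_eq0 p f : Hp p f -> Hp_norm2 p f = 0 -> forall x, f x = 0.
Proof.
move=> /Hp_coef[a /has_power_seriesP fa ca] f0 x; rewrite f0 in ca.
have a0 m : a m = 0.
  have nd : nondecreasing_seq (series (Hp_weighted p a)).
    by apply/nondecreasing_seqP => n; rewrite seriesSr lerDl Hp_weighted_ge0.
  have cv : cvgn (series (Hp_weighted p a)) by apply/cvg_ex; exists 0.
  have := nondecreasing_cvgn_le nd cv m.+1; rewrite (cvg_lim _ ca) //.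
  rewrite seriesSr => le0.
  have s0 : 0 <= series (Hp_weighted p a) m.
    by apply: sumr_ge0 => k _; exact: Hp_weighted_ge0.
  have : Hp_weighted p a m <= 0 by apply: le_trans le0; rewrite lerDr.
  rewrite Hp_weightedE pmulr_rle0 ?weight_gt0 // => n0.
  apply: eq0_normc; apply/eqP; rewrite -sqrf_eq0 eq_le n0; exact: sqr_ge0.
apply: has_sum_unique (fa x) _.
by apply: has_sum_ext (has_sum0 R) => m; rewrite a0 mul0r.
Qed.

Section KernelCombination.
Variables (I : finType) (p : nat) (z : I -> R[i]).
Implicit Type c : I -> R[i].

Definition kernel_comb c x : R[i] := \sum_j c j * touchard_kernel p x (z j).

Definition kernel_comb_coef c m : R[i] :=
  \sum_j c j * (kernel_coef R p m * ((z j)^*)%C ^+ m).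

Lemma kernel_comb_series c : has_power_series (kernel_comb c) (kernel_comb_coef c).
Proof.
apply/has_power_seriesP => x.
have := has_sum_bigsum (index_enum I)
  (fun j : I => has_sumMl (c j) (has_sum_kernel p x (z j))).
apply: has_sum_ext => m; rewrite mulr_suml; apply: eq_bigr => j _.
by rewrite exprMn; ring.
Qed.

(** The real part of <f, sum_j c_j K(., z_j)> = sum_j conj(c_j) f(z_j): the
    weight cancels the kernel coefficient, and each term becomes a term of the
    power series of f at z_j. *)
Lemma kernel_comb_reproducing c f a : has_power_series f a ->
  series (fun m => weight p m * complex.Re ((kernel_comb_coef c m)^*%C * a m))
    @ \oo --> complex.Re (\sum_j (c j)^*%C * f (z j)).
Proof.
move/has_power_seriesP => fa.
have := has_sum_bigsum (index_enum I) (fun j : I => has_sumMl ((c j)^*)%C (fa (z j))).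
move/has_sum_Re; rewrite [X in X @ _ --> _](_ : _ = series
  (fun m => weight p m * complex.Re ((kernel_comb_coef c m)^*%C * a m))) //.
congr series; apply/funext => m; rewrite -ReMl; congr complex.Re.
rewrite rmorph_sum mulr_suml mulr_sumr; apply: eq_bigr => j _.
have conj_term (r : R) : ((c j * ((r%:C)%C * ((z j)^*)%C ^+ m))^*)%C =
    (c j)^*%C * ((r%:C)%C * z j ^+ m).
  by rewrite !rmorphM rmorphXn; congr (_ * (_ * _ ^+ _)); [exact: conjc_real|exact: conjcK].
rewrite kernel_coefE [X in X * a m](_ : _ =
  (c j)^*%C * ((((weight p m)^-1)%:C)%C * z j ^+ m)); last exact: conj_term.
rewrite fmorphV.
have w0 : ((weight p m)%:C)%C != 0 :> R[i].
  by rewrite (inj_eq (@complexI _) _ 0) gt_eqF // weight_gt0.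
by field.
Qed.

(** The squared norm is the case of the reproducing property where f is the
    combination itself; its convergence gives membership in H_p. *)
Lemma kernel_comb_Hp c : Hp p (kernel_comb c) /\
  Hp_norm2 p (kernel_comb c) = complex.Re (\sum_j (c j)^*%C * kernel_comb c (z j)).
Proof.
apply: HpP; first exact: kernel_comb_series.
rewrite (_ : Hp_weighted p _ = fun m => weight p m *
  complex.Re ((kernel_comb_coef c m)^*%C * kernel_comb_coef c m)).
  by apply: kernel_comb_reproducing; exact: kernel_comb_series.
apply/funext => m.
by rewrite Hp_weightedE Re_conjM.
Qed.

Lemma HpD_kernel_comb c g : Hp p g ->
  Hp p (fun x => g x + kernel_comb c x) /\
  Hp_norm2 p (fun x => g x + kernel_comb c x) =
    Hp_norm2 p g + Hp_norm2 p (kernel_comb c)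
    + 2 * complex.Re (\sum_j (c j)^*%C * g (z j)).
Proof.
move=> /Hp_coef[b gb Nb].
apply: (@HpP _ _ (fun m => b m + kernel_comb_coef c m) _).
  apply/has_power_seriesP => x.
  have /has_power_seriesP/(_ x) h1 := gb.
  have /has_power_seriesP/(_ x) h2 := @kernel_comb_series c.
  by apply: has_sum_ext (has_sumD h1 h2) => m; rewrite mulrDl.
have [/Hp_coef[k ck Nk] _] := kernel_comb_Hp c.
have kE : k = kernel_comb_coef c.
  by rewrite -(power_series_coefE ck) (power_series_coefE (@kernel_comb_series c)).
rewrite {}kE in Nk.
have h := @kernel_comb_reproducing c _ _ gb.
rewrite (_ : Hp_weighted p _ = fun m => Hp_weighted p b m +
    Hp_weighted p (kernel_comb_coef c) m +
    2 * (weight p m * complex.Re ((kernel_comb_coef c m)^*%C * b m))).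
  exact: cvg_series_sqrD Nb Nk h.
by apply/funext => m; rewrite !Hp_weightedE normc_sqrD; ring.
Qed.

End KernelCombination.

(** * The regularized risk *)

Section Risk.
Variables (n p : nat) (lambda : R) (z w : 'I_n.+1 -> R[i]).
Implicit Type c : 'I_n.+1 -> R[i].
Local Notation J := (regularized_risk p lambda z w).
Local Notation K := (kernel_comb p z).

Lemma risk_expansion c d : Hp p d ->
  J (fun x => d x + K c x) = J (K c)
    + (\sum_k normc (d (z k)) ^+ 2 + lambda * Hp_norm2 p d)
    + 2 * complex.Re (\sum_k ((lambda%:C)%C * c k - (w k - K c (z k)))^*%C * d (z k)).
Proof.
move=> hd; rewrite /regularized_risk (HpD_kernel_comb z c hd).2.
rewrite (eq_bigr (fun k => normc (w k - K c (z k)) ^+ 2 + normc (d (z k)) ^+ 2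
   - 2 * complex.Re ((w k - K c (z k))^*%C * d (z k)))); last first.
  by move=> k _; rewrite -normc_sqrB; congr (normc _ ^+ _); ring.
rewrite sumrB big_split /= -mulr_sumr -Re_sum.
have -> : complex.Re (\sum_k ((lambda%:C)%C * c k - (w k - K c (z k)))^*%C * d (z k)) =
  lambda * complex.Re (\sum_k (c k)^*%C * d (z k))
  - complex.Re (\sum_k (w k - K c (z k))^*%C * d (z k)).
  rewrite -ReMl mulr_sumr !Re_sum -sumrB; apply: eq_bigr => k _.
  by case: (c k) (w k - _) (d _) => [? ?] [? ?] [? ?] /=; ring.
move: (Hp_norm2 p d) (Hp_norm2 p (K c)) (complex.Re _) (complex.Re _) => N NK P E.
move: (\sum_i _) (\sum_i _) => S1 S2; ring.
Qed.

Lemma kernel_combZ (t : R[i]) c x : K (fun j => t * c j) x = t * K c x.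
Proof. by rewrite /kernel_comb mulr_sumr; apply: eq_bigr => j _; rewrite mulrA. Qed.

Hypothesis lambda_gt0 : 0 < lambda.

Lemma kernel_comb_is_minimizer c :
  (forall k, w k = (lambda%:C)%C * c k + K c (z k)) ->
  is_the_minimizer (@Hp R p) J (K c).
Proof.
move=> wE.
have JE d : Hp p d -> J (fun x => d x + K c x) = J (K c)
    + (\sum_k normc (d (z k)) ^+ 2 + lambda * Hp_norm2 p d).
  move=> hd; rewrite risk_expansion //.
  have -> : \sum_k ((lambda%:C)%C * c k - (w k - K c (z k)))^*%C * d (z k) = 0.
    by rewrite big1 // => k _; rewrite wE addrK subrr conjc0 mul0r.
  by rewrite mulr0 addr0.
(* diff g = g - K c, written as a sum so that it is in H_p by HpD_kernel_comb. *)
pose diff g x := g x + K (fun j => -1 * c j) x.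
have diff_Hp g : Hp p g -> Hp p (diff g).
  by move=> hg; have [] := HpD_kernel_comb z (fun j => -1 * c j) hg.
have diffK g : (fun x => diff g x + K c x) = g.
  by apply/funext => x; rewrite /diff kernel_combZ mulN1r subrK.
have J_diff g : Hp p g -> J g = J (K c)
    + (\sum_k normc (diff g (z k)) ^+ 2 + lambda * Hp_norm2 p (diff g)).
  by move=> hg; have := JE _ (diff_Hp _ hg); rewrite diffK.
have sq_ge0 (d : R[i] -> R[i]) : 0 <= \sum_k normc (d (z k)) ^+ 2.
  by apply: sumr_ge0 => k _; exact: sqr_ge0.
have hmin : is_minimizer (@Hp R p) J (K c).
  split=> [|g hg]; first by have [] := kernel_comb_Hp p z c.
  rewrite (J_diff _ hg) lerDl; apply: addr_ge0; first exact: sq_ge0.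
  apply: mulr_ge0; first exact: ltW.
  by apply: Hp_norm2_ge0; exact: diff_Hp.
split=> // g [hg /(_ (K c) hmin.1)].
have hd := diff_Hp _ hg.
rewrite (J_diff _ hg) gerDl => le0.
have N0 : Hp_norm2 p (diff g) = 0.
  have N_ge0 := Hp_norm2_ge0 hd; have S_ge0 := sq_ge0 (diff g).
  apply/eqP; rewrite eq_le N_ge0 andbT -(pmulr_rle0 _ lambda_gt0).
  by apply: le_trans le0; rewrite lerDr.
rewrite -(diffK g); apply/funext => x.
by rewrite (Hp_norm2_eq0 hd N0) add0r.
Qed.

(** The test direction is minus the combination with coefficients e, so that the
    linear term of the risk is - 2 t times the Gram form at e. *)
Lemma minimizer_weights c : posdefmx (touchard_gram p z) ->
  is_minimizer (@Hp R p) J (K c) ->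
  forall k, w k = (lambda%:C)%C * c k + K c (z k).
Proof.
move=> [_ posG] [_ minJ] k0.
pose e k := (lambda%:C)%C * c k - (w k - K c (z k)).
suff e0 : e k0 = 0 by move/eqP: e0; rewrite subr_eq0 => /eqP ->; rewrite subrK.
apply/eqP; rewrite -[_ == _]negbK; apply/negP => ek0.
pose Q := complex.Re (\sum_k (e k)^*%C * K e (z k)).
have Q0 : 0 < Q.
  have := posG e (ex_intro _ k0 ek0); rewrite ltcE => /andP[_].
  congr (_ < complex.Re _); apply: eq_bigr => k _.
  rewrite mulr_sumr; apply: eq_bigr => j _; rewrite mxE; ring.
pose A := \sum_k normc (K e (z k)) ^+ 2 + lambda * Q.
have A0 : 0 < A.
  by rewrite ltr_wpDl ?mulr_gt0 //; apply: sumr_ge0 => k _; exact: sqr_ge0.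
(* The increment A t^2 - 2 Q t is minimal, equal to - Q^2 / A, at t = Q / A. *)
pose t := Q / A.
have t0 : 0 < t by rewrite divr_gt0.
pose ct : R[i] := ((- t)%:C)%C.
have nct : normc ct ^+ 2 = t ^+ 2 by rewrite normc_sqr /=; ring.
have sqr_ct : ((t ^+ 2)%:C)%C = ct * ct by rewrite /ct -rmorphM mulrNN.
have conj_ct x : ((ct * x)^*)%C = ct * (x^*)%C.
  by rewrite rmorphM; congr (_ * _); exact: conjc_real.
pose d := K (fun j => ct * e j).
have dE x : d x = ct * K e x by rewrite /d kernel_combZ.
have [d_Hp d_norm] := kernel_comb_Hp p z (fun j => ct * e j).
have : 0 <= (\sum_k normc (d (z k)) ^+ 2 + lambda * Hp_norm2 p d)
    + 2 * complex.Re (\sum_k (e k)^*%C * d (z k)).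
  have := minJ _ (HpD_kernel_comb z c d_Hp).1.
  by rewrite (risk_expansion c d_Hp) -[leRHS]addrA lerDl.
have -> : Hp_norm2 p d = t ^+ 2 * Q.
  rewrite d_norm -/d /Q -ReMl mulr_sumr; congr complex.Re; apply: eq_bigr => k _.
  by rewrite conj_ct dE sqr_ct; ring.
have -> : \sum_k normc (d (z k)) ^+ 2 = t ^+ 2 * \sum_k normc (K e (z k)) ^+ 2.
  by rewrite mulr_sumr; apply: eq_bigr => k _; rewrite dE normcM exprMn nct.
have -> : complex.Re (\sum_k (e k)^*%C * d (z k)) = - t * Q.
  by rewrite /Q -ReMl mulr_sumr; congr complex.Re; apply: eq_bigr => k _; rewrite dE mulrCA.
have tA : t * A = Q by rewrite /t divfK // gt_eqF.
move=> le0.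
have : t * (t * A) - 2 * (t * Q) >= 0 by move: le0; rewrite /A; lra.
rewrite tA leNgt => /negP; apply.
have := mulr_gt0 t0 Q0; lra.
Qed.

End Risk.
End Hilbert.

Theorem proposition5p16 (R : realType) (p n : nat) (a lambda : R)
    (h : forall m : nat, 'I_m.+1 -> R)
    (Z : forall m : nat, R -> 'I_m.+1 -> R[i])
    (w : 'I_n.+1 -> R[i]) :
  (1 <= n)%N -> 1 < a -> 0 < lambda ->
  (forall j : 'I_n.+1, `|h n j| <= 1) ->
  posdefmx (touchard_gram p (node (h n))) ->
  is_the_minimizer (@Hp R p)
    (regularized_risk p lambda (node (h n)) w)
    (touchard_superoscillation p (h n) (Z n a))
  <->
  (forall k : 'I_n.+1,
     w k = ((lambda%:C)%C * Z n a k
            + \sum_(j < n.+1) Z n a j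
                * touchard_kernel p (- 'i%C * ((h n k)%:C)%C)
                                    (- 'i%C * ((h n j)%:C)%C))%R).
Proof.
move=> _ _ lambda0 _ posG.
have -> : touchard_superoscillation p (h n) (Z n a) =
  kernel_comb p (node (h n)) (Z n a) by [].
split=> [[minF _]|wE]; first exact: minimizer_weights minF.
exact: kernel_comb_is_minimizer.
Qed.
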